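(* Let $G$ be a finite non-solvable group. Then for all $n$ there exists a word $w\in F_{n}$ such that $G$ is not a quotient of $F_{n}/\langle w\rangle$, that is, there is no surjective homomorphism $F_n/\langle w\rangle\to G$.
   Context: $F_{n}$ denotes the free group on $n$ letters ($n$ a natural number). For $w\in F_{n}$, $F_{n}/\langle w\rangle$ denotes the one-relator group defined by $w$, i.e. the quotient of $F_n$ by the normal closure of $w$. *)

(* Defs.v *)
From HB Require Import structures.
From mathcomp Require Import all_boot all_fingroup all_solvable.
From mathcomp Require Import generic_quotient boolp classical_sets.

Set Implicit Arguments.
Unset Strict Implicit.
Unset Printing Implicit Defensive.

Import GroupScope.
Local Open Scope quotient_scope.

Section FreeGroup.
Variable n : nat.

(* The free group on x_0, ..., x_(n-1) is the set of freely reduced words.    *)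
(* (i, false) stands for the generator x_i and (i, true) for its inverse.     *)
Definition letter : Type := 'I_n * bool.

Definition letter_inv (a : letter) : letter := (a.1, ~~ a.2).

Definition reduced (s : seq letter) : bool :=
  sorted (fun a b => b != letter_inv a) s.

Definition reduced_cons (a : letter) (s : seq letter) : seq letter :=
  if s is b :: s' then if b == letter_inv a then s' else a :: s else [:: a].

Lemma letter_invK : involutive letter_inv.
Proof. by case=> i b; rewrite /letter_inv /= negbK. Qed.

Lemma reduced_behead a s : reduced (a :: s) -> reduced s.
Proof. by case: s => //= b s /andP[]. Qed.

Lemma reduced_reduced_cons a s : reduced s -> reduced (reduced_cons a s).
Proof.
case: s => //= b s; case: eqVneq => [_|ne] /= sP; first exact: (@reduced_behead b).
by rewrite ne.
Qed.

Lemma reduced_consK a s : reduced s ->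
  reduced_cons a (reduced_cons (letter_inv a) s) = s.
Proof.
case: s => [|b s] /=; first by rewrite eqxx.
rewrite letter_invK; case: (eqVneq b a) => [->|ne] /=; last by rewrite eqxx.
by case: s => //= c s /andP[/negPf-> _].
Qed.

Record free_group : Type :=
  FreeGroup { fg_word :> seq letter; fg_wordP : reduced fg_word }.

HB.instance Definition _ := [isSub for fg_word].
HB.instance Definition _ := [Countable of free_group by <:].

Lemma reduced_foldr s t : reduced t -> reduced (foldr reduced_cons t s).
Proof. by elim: s => //= a s IHs /IHs; apply: reduced_reduced_cons. Qed.

Lemma foldr_reduced_cons a s t : reduced t ->
  foldr reduced_cons t (reduced_cons a s)
    = reduced_cons a (foldr reduced_cons t s).
Proof.
move=> tP; case: s => //= b s; case: eqVneq => [->|//].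
by rewrite reduced_consK ?reduced_foldr.
Qed.

Lemma foldr_reduced s t u : reduced u ->
  foldr reduced_cons (foldr reduced_cons u t) s
    = foldr reduced_cons u (foldr reduced_cons t s).
Proof. by move=> uP; elim: s => //= a s ->; rewrite foldr_reduced_cons. Qed.

Lemma foldr_reduced_nil s : reduced s -> foldr reduced_cons [::] s = s.
Proof.
elim: s => //= a s IHs sP; rewrite (IHs (reduced_behead sP)).
by case: s {IHs} sP => //= b s /andP[/negPf-> _].
Qed.

Lemma reduced_inv s : reduced s -> reduced (rev (map letter_inv s)).
Proof.
rewrite /reduced rev_sorted sorted_map; apply: sub_sorted => a b /=.
by apply: contra_neq => /(congr1 letter_inv); rewrite !letter_invK => ->; rewrite letter_invK.
Qed.

Definition fg_one : free_group := @FreeGroup [::] isT.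
Definition fg_mul (x y : free_group) : free_group :=
  FreeGroup (reduced_foldr x (fg_wordP y)).
Definition fg_inv (x : free_group) : free_group :=
  FreeGroup (reduced_inv (fg_wordP x)).

Lemma fg_mulA : associative fg_mul.
Proof. by move=> x y z; apply: val_inj; apply: foldr_reduced (fg_wordP z). Qed.

Lemma fg_mul1 : left_id fg_one fg_mul.
Proof. by move=> x; apply: val_inj. Qed.

Lemma fg_mulr1 : right_id fg_one fg_mul.
Proof. by move=> x; apply: val_inj; apply: foldr_reduced_nil (fg_wordP x). Qed.

Lemma fg_mulV : left_inverse fg_one fg_inv fg_mul.
Proof.
move=> x; apply: val_inj => /=; case: x => /= s _; elim: s => //= a s IHs.
rewrite rev_cons foldr_rcons /= letter_invK eqxx; exact: IHs.
Qed.

Lemma fg_invK : involutive fg_inv.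
Proof.
move=> x; apply: val_inj; rewrite /= map_rev revK mapK //.
exact: letter_invK.
Qed.

Lemma fg_mulrV : right_inverse fg_one fg_inv fg_mul.
Proof. by move=> x; rewrite -{1}[x]fg_invK fg_mulV. Qed.

HB.instance Definition _ :=
  isGroup.Build free_group fg_mulA fg_mul1 fg_mulr1 fg_mulV fg_mulrV.

End FreeGroup.

Section NormalClosure.
Variable G : groupType.

Definition normal_subgroup (N : set G) : Prop :=
  [/\ N 1,
      forall x y, N x -> N y -> N (x * y),
      forall x, N x -> N x^-1
    & forall x y, N x -> N (x ^ y)].

Definition normal_closure (A : set G) : set G := smallest normal_subgroup A.

Lemma normal_closure_normal A : normal_subgroup (normal_closure A).
Proof.
split=> [N [] []//|x y Nx Ny N NP|x Nx N NP|x y Nx N NP]; have [[_ NM NV NJ] _] := NP.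
- by apply: NM; [apply: Nx|apply: Ny].
- by apply: NV; apply: Nx.
- by apply: NJ; apply: Nx.
Qed.

Lemma sub_normal_closure A x : A x -> normal_closure A x.
Proof. by move=> Ax N [_]; apply. Qed.

End NormalClosure.

Section Quotient.
Variables (G : groupType) (A : set G).

Local Notation N := (normal_closure A).

(* Membership in N need not be decidable, hence the boolean of boolp.         *)
Definition nc_equiv : rel G := fun x y => `[< N (x^-1 * y) >].

Lemma nc_equiv_refl : reflexive nc_equiv.
Proof. by move=> x; apply/asboolP; rewrite mulVg; case: (normal_closure_normal A). Qed.

Lemma nc_equiv_sym : symmetric nc_equiv.
Proof.
have [_ _ NV _] := normal_closure_normal A.
by move=> x y; apply/asboolP/asboolP=> /NV; rewrite invgM invgK.
Qed.

Lemma nc_equiv_trans : transitive nc_equiv.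
Proof.
have [_ NM _ _] := normal_closure_normal A.
move=> y x z /asboolP Nxy /asboolP Nyz; apply/asboolP.
by have:= NM _ _ Nxy Nyz; rewrite mulgA mulgK.
Qed.

Canonical nc_equiv_rel :=
  EquivRel nc_equiv nc_equiv_refl nc_equiv_sym nc_equiv_trans.

Definition nc_quotient : Type := {eq_quot nc_equiv}.

HB.instance Definition _ := Choice.on nc_quotient.
HB.instance Definition _ := EqQuotient.on nc_quotient.

Definition ncq_one : nc_quotient := \pi_nc_quotient (1 : G).
Definition ncq_mul (x y : nc_quotient) : nc_quotient :=
  \pi_nc_quotient (repr x * repr y).
Definition ncq_inv (x : nc_quotient) : nc_quotient :=
  \pi_nc_quotient (repr x)^-1.

Lemma pi_eqP x y : reflect (\pi_nc_quotient x = \pi_nc_quotient y) (nc_equiv x y).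
Proof. exact: eqmodP. Qed.

Lemma repr_equiv x : nc_equiv (repr (\pi_nc_quotient x)) x.
Proof. by apply/pi_eqP; rewrite reprK. Qed.

Lemma ncq_mulE x y :
  ncq_mul (\pi_nc_quotient x) (\pi_nc_quotient y) = \pi_nc_quotient (x * y).
Proof.
have [_ NM _ NJ] := normal_closure_normal A.
apply/pi_eqP/asboolP.
have /asboolP/(NJ _ y) Nx := repr_equiv x; have /asboolP Ny := repr_equiv y.
by have := NM _ _ Ny Nx; rewrite conjgE invgM !mulgA mulgK.
Qed.

Lemma ncq_invE x : ncq_inv (\pi_nc_quotient x) = \pi_nc_quotient x^-1.
Proof.
have [_ _ NV NJ] := normal_closure_normal A.
apply/pi_eqP/asboolP; have /asboolP/NV/(NJ _ x^-1) := repr_equiv x.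
by rewrite conjgE invgM !invgK !mulgA mulgV mul1g.
Qed.

Lemma ncq_mulA : associative ncq_mul.
Proof.
move=> x y z; rewrite -[x]reprK -[y]reprK -[z]reprK.
by rewrite (ncq_mulE (repr y)) (ncq_mulE (repr x) (repr y)) !ncq_mulE mulgA.
Qed.

Lemma ncq_mul1 : left_id ncq_one ncq_mul.
Proof. by move=> x; rewrite -[x]reprK ncq_mulE mul1g. Qed.

Lemma ncq_mulr1 : right_id ncq_one ncq_mul.
Proof. by move=> x; rewrite -[x]reprK ncq_mulE mulg1. Qed.

Lemma ncq_mulV : left_inverse ncq_one ncq_inv ncq_mul.
Proof. by move=> x; rewrite -[x]reprK ncq_invE ncq_mulE mulVg. Qed.

Lemma ncq_mulrV : right_inverse ncq_one ncq_inv ncq_mul.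
Proof. by move=> x; rewrite -[x]reprK ncq_invE ncq_mulE mulgV. Qed.

HB.instance Definition _ :=
  isGroup.Build nc_quotient ncq_mulA ncq_mul1 ncq_mulr1 ncq_mulV ncq_mulrV.

End Quotient.

Definition one_relator_group (n : nat) (w : free_group n) : groupType :=
  nc_quotient [set w]%classic.

(* Main.v *)
Require Import Defs.
From HB Require Import structures.
From mathcomp Require Import all_boot all_fingroup all_solvable.
From mathcomp Require Import generic_quotient boolp.

Set Implicit Arguments.
Unset Strict Implicit.
Unset Printing Implicit Defensive.

Import GroupScope.

(** The quotients of F_n / <w> isomorphic to G are given by the epimorphisms
    F_n -> G that kill w, so it is enough to find a word w which no epimorphism
    F_n -> G maps to 1. There are only finitely many epimorphisms, because each
    of them is determined by the images of the n generators.

    The argument is a group-theoretic version of prime avoidance. Call a proper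
    normal subgroup P prime if [A, B] <= P, with A and B normal, forces A <= P
    or B <= P. A non-solvable finite group G has a prime normal subgroup N
    (exists_prime_normal): if L is a nontrivial perfect subgroup of G, take N
    maximal among the normal subgroups not containing L. Any A and B not inside
    N satisfy L <= NA and L <= NB, hence L = [L, L] <= N[A, B], and [A, B] is
    not inside N.

    Each epimorphism f : F_n -> G now yields the prime normal subgroup
    f^-1(N) of F_n (prime_normal_preim), and finitely many prime normal
    subgroups never cover a group (prime_avoidance), just as finitely many prime
    ideals never cover a commutative ring. A word w outside all of the f^-1(N)
    satisfies f(w) <> 1 for every epimorphism f, since 1 lies in N. *)

(** If A and B are the normal closures of x and y, then [A, B] is the normal
    closure of the commutators [x, y^u]; this turns primality, usually stated
    for pairs of normal subgroups, into a condition on elements. *)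
Definition prime_normal (G : groupType) (P : G -> Prop) : Prop :=
  [/\ normal_subgroup P,
      exists x, ~ P x
    & forall x y, ~ P x -> ~ P y -> exists u, ~ P [~ x, y ^ u]].

(** * Prime avoidance *)

Section PrimeAvoidance.
Variable G : groupType.
Implicit Types K P : G -> Prop.

Lemma normal_subgroup_commL K x y : normal_subgroup K -> K x -> K [~ x, y].
Proof. by case=> _ KM KV KJ Kx; apply: KM; [apply: KV | apply: KJ]. Qed.

Lemma normal_subgroup_commR K x y : normal_subgroup K -> K y -> K [~ x, y].
Proof.
by case=> _ KM KV KJ Ky; rewrite commgEr; apply: KM => //; apply/KJ/KV.
Qed.

Lemma normal_subgroup_cancelR K x y : normal_subgroup K -> K y -> K (x * y) -> K x.
Proof. by case=> _ KM KV _ Ky Kxy; rewrite -[x](mulgK y); apply/KM/KV. Qed.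

Lemma normal_subgroup_cancelL K x y : normal_subgroup K -> K x -> K (x * y) -> K y.
Proof. by case=> _ KM KV _ Kx Kxy; rewrite -[y](mulKg x); apply: KM => //; apply: KV. Qed.

(** The K i not contained in P have an intersection that is not contained in P
    either, as for a prime ideal and finitely many ideals. If y outside P
    works for the earlier subgroups and z in the new one is outside P, then
    some [y, z^u] is outside P, and it lies in every normal subgroup
    containing y or z. *)
Lemma prime_normal_bigcap (I : eqType) (K : I -> G -> Prop) P (s : seq I) :
    (forall i, i \in s -> normal_subgroup (K i)) -> prime_normal P ->
  exists2 y, ~ P y & forall i, i \in s -> K i y \/ (forall x, K i x -> P x).
Proof.
move=> nK [_ [x0 Px0] primeP]; elim: s nK => [_ | j s IHs nK]; first by exists x0.
have [|y Py Ky] := IHs; first by move=> k sk; apply: nK; rewrite inE sk orbT.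
have [sKP | /existsNP[z /not_implyP[Kz Pz]]] := pselect (forall x, K j x -> P x).
  by exists y => // i /predU1P[-> | /Ky]; [right | ].
have [u Pu] := primeP y z Py Pz; exists [~ y, z ^ u] => // i.
have nKi: i \in j :: s -> normal_subgroup (K i) by apply: nK.
rewrite inE => /predU1P[-> | si].
  have nKj := nK j (mem_head j s); case: (nKj) => _ _ _ KJ.
  by left; apply: normal_subgroup_commR => //; apply: KJ.
have [Kiy | ] := Ky i si; last by right.
by left; apply: normal_subgroup_commL => //; apply: nKi; rewrite inE si orbT.
Qed.

(** If x avoids all the K j but lies in K i, multiply it by an element y outside
    K i that lies in each K j not contained in K i. The product is outside
    K i, hence also outside the K j contained in K i. *)
Lemma prime_avoidance (I : eqType) (K : I -> G -> Prop) (s : seq I) :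
    (forall i, i \in s -> prime_normal (K i)) ->
  exists x, forall i, i \in s -> ~ K i x.
Proof.
elim: s => [_ | i s IHs primeK]; first by exists 1.
have primeKs j: j \in s -> prime_normal (K j).
  by move=> sj; apply: primeK; rewrite inE sj orbT.
have nKs j: j \in s -> normal_subgroup (K j) by case/primeKs.
have primeKi := primeK i (mem_head i s); have [nKi _ _] := primeKi.
have [x Kx] := IHs primeKs.
have [Kix | Kix] := pselect (K i x); last first.
  by exists x => j /predU1P[-> | /Kx].
have [y Kiy Ky] := prime_normal_bigcap nKs primeKi.
have Kixy: ~ K i (x * y) by move/(normal_subgroup_cancelL nKi Kix).
exists (x * y) => j; rewrite inE => /predU1P[-> // | sj].
have [Kjy | sKij] := Ky j sj; last by move/sKij.
by move/(normal_subgroup_cancelR (nKs j sj) Kjy); apply: Kx.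
Qed.

End PrimeAvoidance.

(** * A prime normal subgroup of a non-solvable finite group *)

Lemma normal_subgroup_setT (gT : finGroupType) (N : {group gT}) :
  N <| [set: gT] -> normal_subgroup (fun x => x \in N).
Proof.
case/andP=> _ nNG; split=> [|x y|x|x y]; [exact: group1 | exact: groupM | | ].
  by rewrite groupV.
by move=> Nx; rewrite memJ_norm // (subsetP nNG) ?inE.
Qed.

(** Non-solvability enters through a perfect L <> 1: because L = [L, L], a
    normal subgroup containing [A, B] contains L as soon as A and B do. *)
Lemma exists_prime_normal (gT : finGroupType) :
    ~~ solvable [set: gT] ->
  exists N : {group gT}, prime_normal (fun x => x \in N).
Proof.
case/forallPn=> L; rewrite negb_imply subsetI => /andP[/andP[_ perfectL] ntL].
pose avoidsL (N : {group gT}) := (N <| [set: gT]) && ~~ (L \subset N).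
have [|N /maxgroupP[/andP[nsN notLN] maxN]] := @ex_maxgroup _ avoidsL.
  by exists 1%G; rewrite /avoidsL normal1 subG1.
have nN (A : {set gT}): A \subset 'N(N).
  exact: subset_trans (subsetT A) (normal_norm nsN).
(* By maximality of N, its join with the normal closure of x contains L. *)
have sLjoin x: x \notin N -> L \subset N <*> <<x ^: [set: gT]>>.
  move=> notNx; apply/idPn=> notL; case/negP: notNx.
  have <- : N <*> <<x ^: [set: gT]>> = N.
    apply: (maxN (N <*> <<x ^: [set: gT]>>)%G); last exact: joing_subl.
    rewrite /avoidsL notL andbT /normal subsetT /=.
    by rewrite normsY ?norms_gen ?class_norm ?normal_norm.
  by apply: (subsetP (joing_subr N _)); apply/mem_gen/class_refl.
exists N; split; first exact: normal_subgroup_setT.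
  by have [x _ Nx] := subsetPn notLN; exists x; apply/negP.
move=> x y /negP Nx /negP Ny; apply: contrapT => /forallNP Nxy.
case/negP: notLN; apply: subset_trans perfectL _.
apply: subset_trans (commgSS (sLjoin x Nx) (sLjoin y Ny)) _.
rewrite -quotient_cents2 // !quotientYidl //.
rewrite quotient_gen // quotient_gen // cent_gen gen_subG.
rewrite quotient_cents2 // gen_subG.
apply/subsetP=> _ /imset2P[_ _ /imsetP[u _ ->] /imsetP[v _ ->] ->].
(* Conjugating by u^-1 brings the first argument back to x itself. *)
have -> : [~ x ^ u, y ^ v] = [~ x, y ^ (v * u^-1)] ^ u.
  by rewrite conjRg -conjgM mulgKV.
rewrite memJ_norm ?(subsetP (nN setT)) ?inE //.
by have /contrapT := Nxy (v * u^-1).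
Qed.

(** * Homomorphisms from a free group *)

Section Evaluation.
Variables (n : nat) (gT : finGroupType).
Implicit Types (g : {ffun 'I_n -> gT}) (a : letter n).

Definition eval_letter g a : gT := if a.2 then (g a.1)^-1 else g a.1.

Definition eval_word g (s : seq (letter n)) : gT := \prod_(a <- s) eval_letter g a.

Lemma eval_letter_inv g a : eval_letter g (letter_inv a) = (eval_letter g a)^-1.
Proof. by case: a => i []; rewrite /eval_letter /= ?invgK. Qed.

Lemma eval_reduced_cons g a s :
  eval_word g (reduced_cons a s) = eval_letter g a * eval_word g s.
Proof.
rewrite /eval_word; case: s => [|b s] /=; first by rewrite big_seq1 big_nil mulg1.
case: eqP => [-> | _]; last by rewrite big_cons.
by rewrite big_cons eval_letter_inv mulKVg.
Qed.

Definition eval g (w : free_group n) : gT := eval_word g w.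

Lemma eval1 g : eval g 1 = 1.
Proof. exact: big_nil. Qed.

Lemma evalM g : {morph eval g : v w / v * w}.
Proof.
move=> v w; rewrite /eval /=; elim: (fg_word v) => [|a s IHs].
  by rewrite /eval_word big_nil mul1g.
by rewrite /= eval_reduced_cons IHs /eval_word big_cons mulgA.
Qed.

HB.instance Definition _ g :=
  isUMagmaMorphism.Build (free_group n) gT (eval g) (eval1 g, evalM g).

Definition fg_letter a : free_group n := @FreeGroup n [:: a] isT.

Lemma eval_fg_letter g a : eval g (fg_letter a) = eval_letter g a.
Proof. exact: big_seq1. Qed.

Lemma fg_letter_inv a : fg_letter (letter_inv a) = (fg_letter a)^-1.
Proof. exact: val_inj. Qed.

Lemma fg_word_ind (Q : free_group n -> Prop) :
  Q 1 -> (forall a w, Q w -> Q (fg_letter a * w)) -> forall w, Q w.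
Proof.
move=> Q1 QM [s sP]; elim: s sP => [|a s IHs] sP.
  by rewrite (_ : FreeGroup sP = 1) //; apply: val_inj.
have := QM a _ (IHs (reduced_behead sP)); congr Q; apply: val_inj => /=.
by case: s sP {IHs} => //= b s /andP[/negPf-> _].
Qed.

(** A homomorphism is evaluation at the images of the generators, so there are
    only finitely many of them into a finite group. *)
Lemma morphism_eval (f : UMagmaMorphism.type (free_group n) gT) w :
  f w = eval [ffun i => f (fg_letter (i, false))] w.
Proof.
elim/fg_word_ind: w => [|a w IHw]; first by rewrite !gmulf1.
rewrite gmulfM evalM IHw eval_fg_letter; congr (_ * _).
case: a => i []; rewrite /eval_letter /= ffunE //.
by rewrite -[(i, true)]/(letter_inv (i, false)) fg_letter_inv gmulfV.
Qed.

End Evaluation.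

Lemma prime_normal_preim (F G : groupType) (f : UMagmaMorphism.type F G)
    (P : G -> Prop) :
    (forall y, exists x, f x = y) -> prime_normal P ->
  prime_normal (fun x => P (f x)).
Proof.
move=> surjf [[P1 PM PV PJ] [y0 Py0] primeP]; split.
- split=> [|x y|x|x y]; rewrite ?gmulf1 ?gmulfM ?gmulfV ?gmulfJ //.
  + exact: PM.
  + exact: PV.
  + exact: PJ.
- by have [x fx] := surjf y0; exists x; rewrite fx.
move=> x y Px Py; have [v Pv] := primeP _ _ Px Py.
by have [u fu] := surjf v; exists u; rewrite gmulfR gmulfJ fu.
Qed.

Lemma nc_quotient_pi_rel (G : groupType) (A : G -> Prop) (w : G) :
  A w -> \pi_(nc_quotient A)%qT w = 1 :> nc_quotient A.
Proof.
move=> Aw; apply/pi_eqP; rewrite nc_equiv_sym; apply/asboolP.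
by rewrite invg1 mul1g; apply: sub_normal_closure.
Qed.

Theorem corollary2 (gT : finGroupType) (hG : ~~ solvable [set: gT]) (n : nat) :
  exists w : free_group n,
    ~ exists f : {multiplicative one_relator_group w -> gT},
        forall y : gT, exists x : one_relator_group w, f x = y.
Proof.
have [N primeN] := exists_prime_normal hG.
pose epi (g : {ffun 'I_n -> gT}) :=
  `[< forall y, exists w : free_group n, eval g w = y >].
pose K g (w : free_group n) : Prop := eval g w \in N.
(* The prime normal subgroups f^-1(N) are indexed by generating n-tuples of G. *)
have [g | w avoid_w] := @prime_avoidance _ _ K (enum epi).
  rewrite mem_enum => /asboolP surj_g.
  exact: prime_normal_preim surj_g primeN.
exists w => -[f surjf].
pose q (x : free_group n) : one_relator_group w := \pi_(one_relator_group w)%qT x.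
have fqM: {morph f \o q : x y / x * y}.
  by move=> x y; rewrite /= -gmulfM; congr (f _); rewrite /q -ncq_mulE.
have fq1: (f \o q) 1 = 1 by apply: (mulgI ((f \o q) 1)); rewrite -fqM !mulg1.
pose h : UMagmaMorphism.type (free_group n) gT :=
  HB.pack (f \o q) (isUMagmaMorphism.Build _ _ (f \o q) (fq1, fqM)).
pose g := [ffun i => h (fg_letter (i, false))].
have hE: h =1 eval g by apply: morphism_eval.
apply: (avoid_w g).
  rewrite mem_enum; apply/asboolP=> y; have [x <-] := surjf y.
  by exists (repr x); rewrite -hE /h /= /q reprK.
have qw1: q w = q 1 by apply: nc_quotient_pi_rel.
by rewrite /K -hE /h /= qw1 -[f (q 1)]/((f \o q) 1) fq1 group1.
Qed.
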